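(* Assume the Axiom of Choice. Let $X,Y$ be nonempty sets and let $F_1\colon X\to Y$ and $F_2\colon X^2\to Y$ be two functions. Then there exists a preassociative and unarily quasi-range-idempotent standard function $G\colon X^*\to Y$ such that $G_1=F_1$ and $G_2=F_2$ if and only if $\mathrm{ran}(F_2)\subseteq\mathrm{ran}(F_1)$ and there exists $g\in Q(F_1)$ such that, setting $H_1=g\circ F_1$ and $H_2=g\circ F_2$, the following conditions hold: (i) $H_2=H_2\circ(H_1,\mathrm{id})=H_2\circ(\mathrm{id},H_1)$; (ii) $H_2$ is associative, i.e., $H_2(H_2(xy)z)=H_2(xH_2(yz))$ for all $x,y,z\in X$. Such a function $G$ is then uniquely determined by $G_0$ and $G_n=G_2\circ(g\circ G_{n-1},\mathrm{id})$ for $n\geqslant 3$.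
   Context: $X^*=\bigcup_{n\geqslant 0}X^n$ is the set of all finite strings over $X$ (vectors in $X^n$ are regarded as strings of length $n$), with $X^0=\{\varepsilon\}$, where $\varepsilon$ is the empty string. Concatenation is denoted by juxtaposition, and $\varepsilon$ is neutral for it. For a function $G\colon X^*\to Y$, $G_n=G|_{X^n}$ and $G^{\flat}=G|_{X^*\setminus\{\varepsilon\}}$. $\mathrm{ran}$ and $\mathrm{dom}$ denote range and domain; $\mathrm{id}$ is the identity on $X$ (and $\mathrm{id}|_{S}$ denotes the identity on a set $S$). $G\colon X^*\to Y$ is standard if $G(\mathbf{x})=G(\varepsilon)$ only if $\mathbf{x}=\varepsilon$. It is preassociative if for all $\mathbf{x},\mathbf{y},\mathbf{y}',\mathbf{z}\in X^*$, $G(\mathbf{y})=G(\mathbf{y}')$ implies $G(\mathbf{x}\mathbf{y}\mathbf{z})=G(\mathbf{x}\mathbf{y}'\mathbf{z})$. It is unarily quasi-range-idempotent if $\mathrm{ran}(G_1)=\mathrm{ran}(G^{\flat})$. $Q(f)$ is the set of quasi-inverses of a function $f$: a function $g$ (with $\mathrm{ran}(f)\subseteq\mathrm{dom}(g)$ and $\mathrm{ran}(g)\subseteq\mathrm{dom}(f)$) is a quasi-inverse of $f$ if $f\circ g|_{\mathrm{ran}(f)}=\mathrm{id}|_{\mathrm{ran}(f)}$ and $\mathrm{ran}(g|_{\mathrm{ran}(f)})=\mathrm{ran}(g)$. For functions $f,h$ of arities $m,n$, $(f,h)(\mathbf{x}\mathbf{y})=f(\mathbf{x})h(\mathbf{y})$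 for $|\mathbf{x}|=m$, $|\mathbf{y}|=n$, where $|\cdot|$ denotes the length of a string; e.g. $(H_2\circ(H_1,\mathrm{id}))(x_1x_2)=H_2(H_1(x_1)x_2)$ and $(G_2\circ(g\circ G_{n-1},\mathrm{id}))(x_1\cdots x_n)=G_2(g(G_{n-1}(x_1\cdots x_{n-1}))x_n)$.
   Formalization: The condition ran(F_1) ≠ Y is added to the right-hand side of the equivalence: a standard G needs G(ε) outside ran(F_1), so the ''if'' part fails when F_1 is onto, e.g. for X = Y = {a}. *)

(* Defs.v *)
From mathcomp Require Import all_boot.
From mathcomp Require Import boolp classical_sets.

Set Implicit Arguments.
Unset Strict Implicit.
Unset Printing Implicit Defensive.

Local Open Scope classical_set_scope.

(* [part1 G] and [part2 G] are the restrictions of a string function G to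
   strings of length 1 and 2, with X^1 identified with X and X^2 with X * X. *)
Definition part1 (X Y : Type) (G : seq X -> Y) : X -> Y :=
  fun x => G [:: x].

Definition part2 (X Y : Type) (G : seq X -> Y) : X * X -> Y :=
  fun p => G [:: p.1; p.2].

(* A standard G takes at [::] a value outside the range of [part1 G], so it
   exists only if [part1 G] is not surjective. *)
Definition standard (X Y : Type) (G : seq X -> Y) : Prop :=
  forall x, G x = G [::] -> x = [::].

Definition preassociative (X Y : Type) (G : seq X -> Y) : Prop :=
  forall x y y' z : seq X,
    G y = G y' -> G (x ++ y ++ z) = G (x ++ y' ++ z).

Definition unarily_quasi_range_idempotent (X Y : Type) (G : seq X -> Y) :
    Prop :=
  range (part1 G) = G @` [set s | s <> [::]].

(* A partial function from Y to X is encoded by its domain D together with a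
   total function g whose values outside D are irrelevant. The condition
   ran(g) `<=` dom(f) holds by typing. *)
Definition quasi_inverse (X Y : Type) (f : X -> Y) (D : set Y) (g : Y -> X) :
    Prop :=
  [/\ range f `<=` D,
      forall y, range f y -> f (g y) = y
    & g @` range f = g @` D].

Definition pairf (A B C D : Type) (f : A -> B) (h : C -> D) : A * C -> B * D :=
  fun p => (f p.1, h p.2).

Definition binary_associative (X : Type) (H : X * X -> X) : Prop :=
  forall x y z, H (H (x, y), z) = H (x, H (y, z)).

(* g is a quasi-inverse of F1 with domain D, and H1 = g o F1, H2 = g o F2
   satisfy (i) and (ii). When range F2 `<=` range F1, both compositions use g
   only inside D. *)
Definition admissible (X Y : Type) (F1 : X -> Y) (F2 : X * X -> Y)
    (D : set Y) (g : Y -> X) : Prop :=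
  let H1 := g \o F1 in
  let H2 := g \o F2 in
  [/\ quasi_inverse F1 D g,
      H2 = H2 \o pairf H1 id,
      H2 \o pairf H1 id = H2 \o pairf id H1
    & binary_associative H2].

(* G_n = G_2 o (g o G_{n-1}, id) for all n >= 3; here n = size (rcons s x). *)
Definition right_recursive (X Y : Type) (g : Y -> X) (G : seq X -> Y) : Prop :=
  forall (s : seq X) (x : X), 2 < size (rcons s x) ->
    G (rcons s x) = part2 G (g (G s), x).

(* Main.v *)
(** A preassociative and unarily quasi-range-idempotent G satisfies
    G s = G [:: g (G s)] for every nonempty s, since G s lies in range F1 and
    g is a right inverse of F1 there. So a nonempty substring may be replaced
    by the single letter g (G s), which gives conditions (i) and (ii) and the
    recursion. Conversely, H2 being associative, one sets
    G (x1 ... xn) = F1 (x1 * ... * xn), where * is H2, and G [::] = e outside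
    range F1; condition (i) says that a * b depends only on F1 a and F1 b,
    which is preassociativity. *)
Require Import Defs.
From mathcomp Require Import all_boot.
From mathcomp Require Import boolp classical_sets.

Set Implicit Arguments.
Unset Strict Implicit.
Unset Printing Implicit Defensive.

Local Open Scope classical_set_scope.

Lemma quasi_inverse_exists (X Y : Type) (f : X -> Y) :
  inhabited X -> exists g : Y -> X, quasi_inverse f (range f) g.
Proof.
move=> [x0].
(* Off [range f] the value is the arbitrary letter [x0]. Taking [range f] itself as the domain makes
   the first and third conditions trivial. *)
have /choice[g fg] : forall y, exists x, range f y -> f x = y.
  move=> y; have [[x _ fx]|nfy] := pselect (range f y); first by exists x.
  by exists x0 => /nfy.
by exists g; split.
Qed.

(** A context around y is built one letter at a time: the left part by [cons], the right part by
    [rcons]. *)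
Lemma preassociative_of_cons_rcons (X Y : Type) (G : seq X -> Y) :
  (forall a y y', G y = G y' -> G (a :: y) = G (a :: y')) ->
  (forall a y y', G y = G y' -> G (rcons y a) = G (rcons y' a)) ->
  preassociative G.
Proof.
move=> Gcons Grcons x y y' z Gy.
elim: x => [|a x IHx] /=; last exact: Gcons.
elim/last_ind: z => [|z a IHz]; first by rewrite !cats0.
by rewrite -!rcons_cat; apply: Grcons.
Qed.

Section UnaryRepresentative.
Variables (X Y : Type) (G : seq X -> Y) (D : set Y) (g : Y -> X).
Hypotheses (preG : preassociative G) (idemG : unarily_quasi_range_idempotent G).

Lemma range_part1 s : s <> [::] -> range (part1 G) (G s).
Proof. by move=> s0; rewrite idemG; exists s. Qed.

Hypothesis gQ : quasi_inverse (part1 G) D g.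

Lemma unary_representative s : s <> [::] -> G [:: g (G s)] = G s.
Proof. by case: gQ => _ gK _ /range_part1 /gK. Qed.

Lemma replace_by_representative x s z :
  s <> [::] -> G (x ++ g (G s) :: z) = G (x ++ s ++ z).
Proof. by move=> /unary_representative /preG; exact. Qed.

Lemma admissible_parts : admissible (part1 G) (part2 G) D g.
Proof.
have repl1 a b : part2 G (g (part1 G a), b) = part2 G (a, b).
  exact: (@replace_by_representative [::] [:: a] [:: b]).
have repl2 a b : part2 G (a, g (part1 G b)) = part2 G (a, b).
  exact: (@replace_by_representative [:: a] [:: b] [::]).
split => //.
- by apply/funext => -[a b]; rewrite /= /pairf /= repl1.
- by apply/funext => -[a b]; rewrite /= /pairf /= repl1 repl2.
- move=> a b c; congr (g _).
  rewrite /part2 /=.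
  (* Both bracketings collapse to [G [:: a; b; c]]. *)
  rewrite (@replace_by_representative [::] [:: a; b] [:: c]) //.
  by rewrite (@replace_by_representative [:: a] [:: b; c] [::]).
Qed.

Lemma right_recursive_of_preassociative : right_recursive g G.
Proof.
move=> s x; case: s => [|a s] // _.
by rewrite /part2 /= (@replace_by_representative [::] (a :: s) [:: x]) // cats1.
Qed.

End UnaryRepresentative.

Lemma right_recursive_inj (X Y : Type) (g : Y -> X) (G G' : seq X -> Y) :
  G [::] = G' [::] -> part1 G = part1 G' -> part2 G = part2 G' ->
  right_recursive g G -> right_recursive g G' -> G = G'.
Proof.
move=> G0 G1 G2 recG recG'; apply/funext; elim/last_ind => // s x IHs.
have [lt2s|] := ltnP 2 (size (rcons s x)).
  by rewrite recG // recG' // IHs G2.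
(* Lengths 1 and 2, below the recursion, are settled by the assumptions on [part1] and [part2]. *)
case: s {IHs} => [|a [|b s]]; last by rewrite /= size_rcons.
- by move=> _; apply: (congr1 (@^~ x) G1).
- by move=> _; apply: (congr1 (@^~ (a, x)) G2).
Qed.

Section FoldExtension.
Variables (X Y : Type) (F1 : X -> Y) (F2 : X * X -> Y) (e : Y).
Variables (D : set Y) (g : Y -> X).
Hypotheses (ranNe : ~ range F1 e) (ranF2 : range F2 `<=` range F1).
Hypothesis admF : admissible F1 F2 D g.

Let H2 := g \o F2.

(** The product under [H2] is bracketed to the left, so appending a letter is one more step of
    [foldl]. *)
Definition fold_ext (s : seq X) : Y :=
  if s is x :: s' then F1 (foldl (fun a b => H2 (a, b)) x s') else e.

Lemma standard_fold_ext : standard fold_ext.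
Proof. by case=> // x s /= E; case: ranNe; rewrite -E; eexists. Qed.

Lemma idempotent_fold_ext : unarily_quasi_range_idempotent fold_ext.
Proof.
apply/seteqP; split=> y.
- by case=> x _ <-; exists [:: x].
- by case=> -[//|x s] _ <-; eexists.
Qed.

Lemma part2_fold_ext : part2 fold_ext = F2.
Proof.
apply/funext => -[a b]; case: admF => -[_ gK _] _ _ _.
by apply: gK; apply: ranF2; exists (a, b).
Qed.

Lemma eq_H2 a a' b b' : F1 a = F1 a' -> F1 b = F1 b' -> H2 (a, b) = H2 (a', b').
Proof.
case: admF => _ El Er _ Ea Eb.
have H2l x y : H2 (x, y) = H2 (g (F1 x), y) := congr1 (@^~ (x, y)) El.
have H2r x y : H2 (x, y) = H2 (x, g (F1 y)) :=
  congr1 (@^~ (x, y)) (etrans El Er).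
by rewrite H2l H2r Ea Eb -H2r -H2l.
Qed.

(** Associativity pulls the first letter out of the left-bracketed product; this handles prepending
    a letter. *)
Lemma foldl_H2_cons a b s :
  foldl (fun u v => H2 (u, v)) (H2 (a, b)) s =
  H2 (a, foldl (fun u v => H2 (u, v)) b s).
Proof.
have assocH2 : binary_associative H2 by case: admF.
by elim: s b => // c s IHs b; rewrite [LHS]/= assocH2 IHs.
Qed.

Lemma preassociative_fold_ext : preassociative fold_ext.
Proof.
(* Standardness excludes an empty string against a nonempty one. For two nonempty strings, [Gst]
   says that their products have the same image under [F1], as [eq_H2] requires. *)
apply: preassociative_of_cons_rcons => a [|b s] [|c t] // Gst.
- by have := standard_fold_ext (esym Gst).
- by have := standard_fold_ext Gst.
- by rewrite /= !foldl_H2_cons; congr F1; apply: eq_H2.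
- by have := standard_fold_ext (esym Gst).
- by have := standard_fold_ext Gst.
- by rewrite /= !foldl_rcons; congr F1; apply: eq_H2.
Qed.

End FoldExtension.

Theorem theorem4p11 (X Y : Type) (hX : inhabited X) (hY : inhabited Y)
    (F1 : X -> Y) (F2 : X * X -> Y) :
  ((exists G : seq X -> Y,
      [/\ preassociative G, unarily_quasi_range_idempotent G, standard G,
          part1 G = F1 & part2 G = F2])
   <->
   [/\ exists e : Y, ~ range F1 e,
       range F2 `<=` range F1
     & exists (D : set Y) (g : Y -> X), admissible F1 F2 D g])
  /\
  (forall (D : set Y) (g : Y -> X), admissible F1 F2 D g ->
   forall G : seq X -> Y,
     preassociative G -> unarily_quasi_range_idempotent G -> standard G ->
     part1 G = F1 -> part2 G = F2 ->
     unique (fun G' : seq X -> Y =>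
               [/\ G' [::] = G [::], part1 G' = F1, part2 G' = F2
                 & right_recursive g G']) G).
Proof.
split; first split.
- move=> [G [preG idemG stdG <- <-]]; split.
  (* Standardness keeps [G [::]] apart from every value on a single letter. *)
  + by exists (G [::]) => -[x _] /stdG.
  + by move=> _ [p _ <-]; apply: range_part1.
  + have [g gQ] := quasi_inverse_exists (part1 G) hX.
    by exists (range (part1 G)), g; apply: admissible_parts.
- move=> [[e ranNe] ranF2 [D [g admF]]]; exists (fold_ext F1 F2 e g); split.
  + exact: preassociative_fold_ext admF.
  + exact: idempotent_fold_ext.
  + exact: standard_fold_ext.
  + by [].
  + exact: part2_fold_ext admF.
- move=> D g [gQ _ _ _] G preG idemG stdG G1 G2; rewrite -G1 in gQ.
  have recG := right_recursive_of_preassociative preG idemG gQ.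
  split=> // G' [G'0 G'1 G'2 recG'].
  by apply: right_recursive_inj recG recG'; rewrite ?G1 ?G2.
Qed.
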